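(* Let $X$ be a complete metric space, $k\ge2$, and let $\mathcal{F}=\{f_1,\dots,f_k\}$ be a finite family of similitudes of $X$ with similarity ratios $c_1,\dots,c_k\in(0,1)$ and attractor $\mathcal{K}$. If $\mathcal{F}$ satisfies the strong open set condition SOSC, then $\mathcal{F}$ satisfies the weak separation condition WSC. The converse is not true in general: there exist a complete metric space $X$ and such a family $\mathcal{F}$ that satisfies the WSC but not the SOSC.
   Context: A similitude of $(X,\rho)$ with ratio $c_i\in(0,1)$ is a map $f_i:X\to X$ with $\rho(f_i(x),f_i(y))=c_i\,\rho(x,y)$ for all $x,y$. The attractor $\mathcal{K}\subseteq X$ is the unique nonempty compact set with $\mathcal{K}=\bigcup_{i=1}^k f_i(\mathcal{K})$. SOSC: there is a nonempty open set $V\subseteq X$ such that the sets $f_i(V)$, $i=1,\dots,k$, are pairwise disjoint and contained in $V$, and $V\cap\mathcal{K}\ne\emptyset$. Let $\Sigma=\{1,\dots,k\}$; for $\mathbf{i}=i_1\cdots i_n\in\Sigma^n$ put $f_{\mathbf{i}}=f_{i_1}\circ\cdots\circ f_{i_n}$. The natural fractal structure on $\mathcal{K}$ is $\mathbf{\Gamma}=\{\Gamma_n\}_{n\ge1}$ with $\Gamma_n=\{f_{\mathbf{i}}(\mathcal{K}):\mathbf{i}\in\Sigma^n\}$; a set may appear more than once in a level, so $\Gamma_n$ is regarded as a family indexed by $\Sigma^n$. WSC: $\mathbf{\Gamma}$ is irreducible, i.e. for each $n$ the covering $\Gamma_n$ of $\mathcal{K}$ has no proper subcovering (for every $\mathbf{i}\in\Sigma^n$,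 $\bigcup_{\mathbf{j}\in\Sigma^n,\,\mathbf{j}\neq\mathbf{i}}f_{\mathbf{j}}(\mathcal{K})\ne\mathcal{K}$). *)

(* Defs.v *)
From HB Require Import structures.
From mathcomp Require Import all_boot all_order all_algebra.
From mathcomp Require Import all_classical all_reals all_analysis.

Set Implicit Arguments.
Unset Strict Implicit.
Unset Printing Implicit Defensive.

Import Order.TTheory GRing.Theory Num.Theory.
Local Open Scope classical_set_scope.
Local Open Scope ring_scope.

(* [completeType] is pointed, hence so is [completeMetricType]; this excludes
   only the empty space, on which there is no nonempty compact set. *)
#[short(type="completeMetricType")]
HB.structure Definition CompleteMetric (R : numDomainType) :=
  {X of Complete X & Metric R X}.

Definition similitude (R : numDomainType) (X : metricType R)
    (f : X -> X) (c : R) : Prop :=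
  0 < c < 1 /\ forall x y : X, mdist (f x) (f y) = c * mdist x y.

Section ifs.
Context {T : topologicalType} {k : nat}.
Implicit Types (f : 'I_k -> T -> T) (K : set T).

(* A finite family is indexed by ['I_k]: maps may be repeated. *)
Definition self_similar f K : Prop :=
  [/\ K !=set0, compact K & K = \bigcup_i (f i @` K)].

Definition is_attractor f K : Prop := unique (self_similar f) K.

Definition sosc f K : Prop :=
  exists V : set T, [/\ open V, V !=set0,
    trivIset setT (fun i => f i @` V),
    forall i, f i @` V `<=` V
    & V `&` K !=set0].

(* [word_map f [:: i1; ..; in]] is [f i1 \o .. \o f in]: the first letter is
   the outermost map. *)
Definition word_map f (w : seq 'I_k) : T -> T :=
  foldr (fun i g => f i \o g) idfun w.

(* A level is kept as a family indexed by the words of length [n], not as a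
   set of sets: two words giving the same piece count twice. *)
Definition fractal_level f K (n : nat) (w : n.-tuple 'I_k) : set T :=
  word_map f w @` K.

Definition irreducible_covering (I : Type) K (A : I -> set T) : Prop :=
  forall i, \bigcup_(j in [set j | j <> i]) A j <> K.

Definition wsc f K : Prop :=
  forall n : nat, (1 <= n)%N -> irreducible_covering K (@fractal_level f K n).

End ifs.

(* Main.v *)
(* SOSC => WSC.  Replacing the family by its n-th iterate (indexed by I), one
   has to show that no single piece can be dropped from the first level.  If
   the i0-th piece could be dropped, then for every t the set K would have
   covers with sum of diam^t equal to (sum over i <> i0 of c_i^t)^q times a
   constant.  Choose t with sum of c_i^t > 1 but sum over i <> i0 of c_i^t < 1,
   so that these sums tend to 0.  On the other hand SOSC gives a small copy
   phi K of K inside V; the maps f_u \o phi, for all words u of a large fixed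
   length, have uniformly separated pieces and sum of ratio^t >= 1, which
   bounds the sum of diam^t of every finite cover of K from below.

   Counterexample to the converse.  On the real line take the maps
   x |-> (x + d) / 7 with d in {0, 1, 2, 3, tau}.  Balanced base 7 expansions
   have digits in {0, .., 3} - {0, .., 3}, so if tau is well approximated by
   such expansions then two distinct words of the same length give maps that
   agree up to an arbitrarily small translation of the argument, and no open
   set has disjoint images.  Since there are 5 < 7 maps, for all tau outside a
   meagre set no nontrivial a + tau * b with integers a and b lies in the
   attractor, so the point f_w(0) belongs to no other piece of its level.
   Baire's theorem provides a tau with both properties. *)
Require Import Defs.
From HB Require Import structures.
From mathcomp Require Import all_boot all_order all_algebra.
From mathcomp Require Import all_classical all_reals all_analysis.
From mathcomp Require Import ring lra zify.

Set Implicit Arguments.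
Unset Strict Implicit.
Unset Printing Implicit Defensive.

Import Order.TTheory GRing.Theory Num.Theory.
Import numFieldNormedType.Exports.
Local Open Scope classical_set_scope.
Local Open Scope ring_scope.

(** * An exponent that separates two sums of powers *)

Lemma powR_ratio_sums (R : realType) (I : finType) (c : I -> R) (i0 : I) :
  (2 <= #|I|)%N -> (forall i, 0 < c i < 1) ->
  exists t : R, [/\ 0 <= t, 1 < \sum_i c i `^ t
    & \sum_(i | i != i0) c i `^ t < 1].
Proof.
move=> I2 c01; pose h (t : R) := \sum_i c i `^ t.
have h0 : h 0 = #|I|%:R.
  rewrite /h (eq_bigr (fun=> 1)) ?sumr_const// => i _.
  by rewrite powRr0.
have hcont : continuous h.
  move=> t; rewrite /h; apply: cvg_big => [|i _]; first exact: add_continuous.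
  have /andP[ci0 _] := c01 i.
  have -> : powR (c i) = fun s => expR (s * ln (c i)).
    by apply/funext => s; rewrite /powR gt_eqF.
  apply: continuous_comp; last exact: continuous_expR.
  exact: mulrr_continuous.
have [n hn] : exists n : nat, h n%:R < 1.
  have hE n : h n%:R = \sum_i c i ^+ n.
    by apply: eq_bigr => i _; rewrite powR_mulrn//; case/andP: (c01 i) => /ltW.
  have : \sum_i c i ^+ n @[n --> \oo] --> (\sum_(i : I) 0 : R).
    apply: cvg_big => [|i _]; first exact: add_continuous.
    apply: cvg_expr; case/andP: (c01 i) => ? ?.
    by rewrite ger0_norm// ltW.
  rewrite big1// => /cvgr_lt /(_ _ ltr01) [n _ /(_ n (leqnn n))] /= hn.
  by exists n; rewrite hE.
have /andP[c0 c1] := c01 i0.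
pose e := c i0 `^ n%:R.
have e0 : 0 < e by exact: powR_gt0.
have e1 : e <= 1.
  by rewrite /e powR_mulrn ?(ltW c0)// exprn_ile1 ?(ltW c0) ?(ltW c1).
have card2 : 2 <= #|I|%:R :> R by rewrite ler_nat.
(* The value [1 + e / 2] is at most 3/2, below [h 0], and it exceeds [h n%:R]. Since [t <= n], the
   term of [i0] is at least [e], which leaves at most [1 - e / 2] for the others. *)
have [||t] := @IVT R h 0 n%:R (1 + e / 2) (ler0n _ _).
- exact: continuous_subspaceT.
- rewrite h0 ge_min le_max; apply/andP; split; apply/orP; [right|left]; lra.
rewrite in_itv/= => /andP[t0 tn] ht; exists t; split => //.
  by rewrite -/(h t) ht; lra.
have et : e <= c i0 `^ t by rewrite /e ger_powR// c0 ltW.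
by move: ht; rewrite /h (bigD1 i0)//=; lra.
Qed.

(** * Distances between points of compact sets *)

Section compact_metric.
Context {R : realType} {X : metricType R}.
Implicit Types A B : set X.

Lemma near_mdist (x y : X) (e : R) : 0 < e ->
  \forall p \near (x, y), `|mdist p.1 p.2 - mdist x y| < e.
Proof.
move=> e0; exists (ball x (e / 2), ball y (e / 2)) => /=.
  by split; apply: nbhsx_ballx; rewrite divr_gt0.
move=> [x' y'] /= []; rewrite !ballEmdist /= => xx' yy'.
have := metric_triangle x x' y; have := metric_triangle x' y' y.
have := metric_triangle x' x y'; have := metric_triangle x y y'.
rewrite (metric_sym x' x) (metric_sym y' y) ltr_norml.
by move: xx' yy' => *; apply/andP; split; lra.
Qed.

(** Near a pair of distinct points, distances stay above half of theirs, and compactness of the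
    product makes this uniform. The filter form lets finitely many such bounds be intersected. *)
Lemma compact_mdist_lb A B : compact A -> compact B -> A `&` B = set0 ->
  \forall d \near 0^'+, forall x y, A x -> B y -> d <= mdist x y :> R.
Proof.
move=> cA cB AB.
have /compact_near_coveringP /(_ R 0^'+) := compact_setX cA cB.
move=> /(_ (fun d p => d <= mdist p.1 p.2) _) ncov.
have : \forall d \near 0^'+, A `*` B `<=` (fun p => d <= mdist p.1 p.2 :> R).
  apply: ncov => -[x y] [/= Ax By].
  have d0 : 0 < mdist x y.
    rewrite mdist_gt0; apply/eqP => xy.
    suff : (A `&` B) x by rewrite AB.
    by split => //; rewrite xy.
  near=> p d; have pxy : `|mdist p.1 p.2 - mdist x y| < mdist x y / 2.
    by near: p; apply: near_mdist; rewrite divr_gt0.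
  have : d < mdist x y / 2 by near: d; apply: nbhs_right_lt; rewrite divr_gt0.
  by move: pxy; rewrite ltr_norml /= => /andP[? ?] ?; lra.
by apply: filterS => d dAB x y Ax By; apply: (dAB (x, y)).
Unshelve. all: by end_near. Qed.

Lemma compact_mdist_ub A B : compact A -> compact B ->
  exists2 d : R, 0 < d & forall x y, A x -> B y -> mdist x y <= d.
Proof.
move=> cA cB.
have /compact_near_coveringP /(_ R +oo) := compact_setX cA cB.
move=> /(_ (fun d p => mdist p.1 p.2 <= d) _) ncov.
have nd : \forall d \near +oo, A `*` B `<=` (fun p => mdist p.1 p.2 <= d :> R).
  apply: ncov => -[x y] _.
  near=> p d; have pxy : `|mdist p.1 p.2 - mdist x y| < 1.
    by near: p; apply: near_mdist.
  have : mdist x y + 1 <= d by near: d; apply: nbhs_pinfty_ge; exact: num_real.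
  by move: pxy; rewrite ltr_norml /= => /andP[? ?] ?; lra.
near (pinfty_nbhs R) => d; exists d => [|x y Ax By].
  by near: d; apply: nbhs_pinfty_gt; exact: num_real.
have /(_ (x, y)) : A `*` B `<=` (fun p => mdist p.1 p.2 <= d) by near: d.
exact.
Unshelve. all: by end_near. Qed.

End compact_metric.

(** * Covers and their contents under families of similitudes *)

Section similitudes.
Context {R : realType} {X : metricType R}.
Implicit Types (f g : X -> X) (K V : set X) (J M : finType).

Lemma similitude_comp f g (c d : R) :
  similitude f c -> similitude g d -> similitude (f \o g) (c * d).
Proof.
move=> [/andP[c0 c1] fE] [/andP[d0 d1] gE]; split.
  by rewrite mulr_gt0//= mulr_ilt1// ltW.
by move=> x y; rewrite /= fE gE mulrA.
Qed.

Lemma similitude_inj f (c : R) : similitude f c -> injective f.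
Proof.
move=> [/andP[c0 c1] fE] x y fxy; apply/mdist_positivity/eqP.
by have := fE x y; rewrite fxy mdistxx => /esym/eqP; rewrite mulf_eq0 gt_eqF.
Qed.

Lemma similitude_continuous f (c : R) : similitude f c -> continuous f.
Proof.
move=> [/andP[c0 c1] fE] x.
apply/metricType_numDomainType.cvgrPdist_lt => e e0.
apply/metricType_numDomainType.nbhs_mdistP; exists (e / c) => /=.
  by rewrite divr_gt0.
by move=> y /=; rewrite ltr_pdivlMr// mulrC fE.
Qed.

(* Induction on the number of sets of the cover.  If all the diameters are
   smaller than [delta], no set of the cover meets two of the pieces
   [G b @` K], so the cover splits into smaller covers of the pieces, each of
   which is rescaled to a cover of [K]. *)
Lemma separated_cover_content_lb J (G : J -> X -> X) (r : J -> R) K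
    (delta t : R) M (P : {set M}) (U : M -> set X) (d : M -> R) :
  (2 <= #|J|)%N -> K !=set0 -> (forall b, similitude (G b) (r b)) ->
  (forall b, G b @` K `<=` K) ->
  (forall b b' x y, b != b' -> K x -> K y ->
    delta <= mdist (G b x) (G b' y)) ->
  0 < delta -> 0 <= t -> 1 <= \sum_b r b `^ t ->
  (forall p, 0 < d p) ->
  (forall p x y, U p x -> U p y -> mdist x y <= d p) ->
  K `<=` \bigcup_(p in [set` P]) U p ->
  delta `^ t <= \sum_(p in P) d p `^ t.
Proof.
move=> J2 [x0 Kx0] simG GK sep delta0 t0 sumr.
have r0 b : 0 < r b by case: (simG b) => /andP[].
have [n] := ubnP #|P|.
elim: n P U d => // n IHn P U d; rewrite ltnS => Pn d0 dU KU.
(* A single set with diameter bound at least [delta] already gives the estimate. *)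
have [/existsP[p /andP[pP dp]]|/existsPn small] :=
    boolP [exists p, (p \in P) && (delta <= d p)].
  rewrite (bigD1 p)//= -[leLHS]addr0 lerD//.
    by rewrite ge0_ler_powR// nnegrE ltW.
  by apply: sumr_ge0 => *; exact: powR_ge0.
pose Q b := [set p in P | `[< exists2 x, K x & U p (G b x) >]]%SET.
have Qdisj b b' : b != b' -> [disjoint Q b & Q b']%B.
  move=> bb'; apply/pred0P => p /=; apply/negbTE/negP.
  rewrite !inE => /andP[/andP[pP /asboolP[x Kx Ux]] /andP[_ /asboolP[y Ky Uy]]].
  have := small p; rewrite pP/= -ltNge ltNge => /negP; apply.
  exact: le_trans (sep _ _ _ _ bb' Kx Ky) (dU _ _ _ Ux Uy).
have Qcover b x : K x -> exists2 p, p \in Q b & U p (G b x).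
  move=> Kx; have [p pP Up] : (\bigcup_(p in [set` P]) U p) (G b x).
    by apply/KU/GK; exists x.
  by exists p => //; rewrite inE;
    apply/andP; split=> //; apply/asboolP; exists x.
(* Some set of the cover meets a second piece and, by disjointness, is not in [Q b]; so [Q b] is a
   proper subset of [P]. *)
have Qn b : (#|Q b| < n)%N.
  apply: leq_trans Pn; apply: proper_card; apply/properP; split.
    by apply/fintype.subsetP => p; rewrite inE => /andP[].
  have [b' bb'] : exists b', b != b'.
    apply/not_existsP => bE.
    have : (#|J| <= #|[set b]%SET|)%N.
      by rewrite -cardsT; apply/subset_leq_card/fintype.subsetP => b' _;
        rewrite inE eq_sym; apply: contra_notT (bE b').
    by rewrite cards1 leqNgt J2.
  have [p pQ _] := Qcover b' _ Kx0; exists p.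
    by move: pQ; rewrite inE => /andP[].
  by apply: contraL pQ => pQ; rewrite (disjointFr (Qdisj _ _ bb') pQ).
(* Preimages under [G b] of the sets in [Q b] cover [K], with diameters divided by [r b]. *)
have Qlb b : r b `^ t * delta `^ t <= \sum_(p in Q b) d p `^ t.
  have := IHn (Q b) (fun p => G b @^-1` U p) (fun p => d p / r b) (Qn b).
  have -> : \sum_(p in Q b) (d p / r b) `^ t =
      (\sum_(p in Q b) d p `^ t) / r b `^ t.
    rewrite mulr_suml; apply: eq_bigr => p _.
    rewrite powRM ?invr_ge0 1?ltW//; congr (_ * _).
    by rewrite -powR_inv1 1?ltW// powRAC powR_inv1// powR_ge0.
  rewrite ler_pdivlMr ?powR_gt0// mulrC; apply.
  - by move=> p; rewrite divr_gt0.
  - move=> p x y Ux Uy; rewrite ler_pdivlMr// mulrC.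
    by case: (simG b) => _ <-; exact: dU.
  - by move=> x /(Qcover b) [p ? ?]; exists p.
apply: (@le_trans _ _ (\sum_b r b `^ t * delta `^ t)).
  by rewrite -mulr_suml ler_peMl// powR_ge0.
apply: le_trans (ler_sum _ (fun b _ => Qlb b)) _.
rewrite -(partition_disjoint_bigcup _ (fun p => d p `^ t) Qdisj).
rewrite big_mkcond/= [leRHS]big_mkcond/=; apply: ler_sum => p _.
case: ifPn => [/bigcupP[b _]|_]; first by rewrite inE => /andP[->].
by case: ifP => // _; exact: powR_ge0.
Qed.

Lemma similitude_family_ratio (I : finType) (F : I -> X -> X) (c : I -> R) :
  (forall i, similitude (F i) (c i)) ->
  exists2 C, 0 < C < 1 & forall i, c i <= C.
Proof.
(* The default [2^-1] keeps the maximum strictly between 0 and 1 even for an empty family. *)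
move=> simF; exists (\big[Num.max/2^-1]_i c i); last first.
  by move=> i; exact: le_bigmax.
apply/andP; split.
  by apply: (@lt_le_trans _ _ 2^-1); [lra|exact: bigmax_ge_id].
apply: bigmax_lt => [|i _]; first by rewrite invf_lt1 ?ltr1n.
by case: (simF i) => /andP[].
Qed.

(** Follow an address of [x]: each further letter multiplies the ratio by at most [C]. The induction
    starts with one letter because the identity has ratio 1 and is no [similitude]. *)
Lemma exists_small_piece (I : finType) (F : I -> X -> X) (c : I -> R) K x e :
  (forall i, similitude (F i) (c i)) -> K = \bigcup_i (F i @` K) ->
  K x -> 0 < e ->
  exists (phi : X -> X) (rho : R),
    [/\ similitude phi rho, phi @` K `<=` K, (phi @` K) x & rho < e].
Proof.
move=> simF KE Kx e0.
have [C /andP[C0 C1] cC] := similitude_family_ratio simF.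
have FK i y : K y -> K (F i y) by move=> Ky; rewrite KE; exists i => //; exists y.
have approx n : forall y, K y -> exists (phi : X -> X) (rho : R),
    [/\ similitude phi rho, phi @` K `<=` K, (phi @` K) y & rho <= C ^+ n.+1].
  elim: n => [|n IHn] y; rewrite {1}KE => -[i _ [z Kz <-]].
    exists (F i), (c i); rewrite expr1.
    split; [exact: simF| |by exists z|exact: cC].
    by move=> _ [w Kw <-]; exact: FK.
  have [phi [rho [simphi phiK [w Kw <-] rhoC]]] := IHn _ Kz.
  exists (F i \o phi), (c i * rho); split.
  - exact: similitude_comp.
  - by move=> _ [v Kv <-]; apply/FK/phiK; exists v.
  - by exists w.
  - case: (simF i) (simphi) => /andP[ci0 _] _ [/andP[rho0 _] _].
    by rewrite exprS ler_pM// ltW.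
have /cvgr_lt /(_ _ e0) [n _ /(_ n.+1 (leqnSn n))/= Cn] :
    C ^+ n @[n --> \oo] --> 0 by apply: cvg_expr; rewrite gtr0_norm.
have [phi [rho [? ? ? rhoC]]] := approx n x Kx.
by exists phi, rho; split => //; exact: le_lt_trans Cn.
Qed.

(** All compositions of [n.+1] maps, indexed by a product of copies of [I], over which the sum of
    powers is multiplicative. A sum above 1 thus grows beyond any bound while the images of [V] stay
    disjoint. *)
Lemma iterated_family (I : finType) (F : I -> X -> X) (c : I -> R) K V t n :
  (2 <= #|I|)%N -> (forall i, similitude (F i) (c i)) ->
  (forall i, F i @` K `<=` K) -> (forall i, F i @` V `<=` V) ->
  (forall i j x y, V x -> V y -> F i x = F j y -> i = j) ->
  exists (J : finType) (G : J -> X -> X) (r : J -> R),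
    [/\ (2 <= #|J|)%N /\ (forall b, similitude (G b) (r b)),
        forall b, G b @` K `<=` K, forall b, G b @` V `<=` V,
        forall b b' x y, V x -> V y -> G b x = G b' y -> b = b'
      & \sum_b r b `^ t = (\sum_i c i `^ t) ^+ n.+1].
Proof.
move=> I2 simF FK FV Fdisj.
elim: n => [|n [J [G [r [[J2 simG] GK GV Gdisj sumr]]]]].
  by exists I, F, c; rewrite expr1.
exists (I * J)%type, (fun p => F p.1 \o G p.2), (fun p => c p.1 * r p.2).
split.
- split; last by move=> p; exact: similitude_comp.
  by rewrite card_prod (leq_trans I2)// leq_pmulr// ltnW.
- by move=> p _ [x Kx <-]; apply: FK; exists (G p.2 x) => //; apply: GK; exists x.
- by move=> p _ [x Kx <-]; apply: FV; exists (G p.2 x) => //; apply: GV; exists x.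
- move=> [i b] [j b'] x y Vx Vy /= FG.
  have GVb b0 z : V z -> V (G b0 z) by move=> Vz; apply: GV; exists z.
  have ij := Fdisj _ _ _ _ (GVb _ _ Vx) (GVb _ _ Vy) FG; move: FG; rewrite ij.
  by move=> /(similitude_inj (simF j)) /(Gdisj _ _ _ _ Vx Vy) ->.
- rewrite exprS -sumr mulr_suml -(pair_bigA _ (fun i b => (c i * r b) `^ t))/=.
  apply: eq_bigr => i _; rewrite mulr_sumr; apply: eq_bigr => b _.
  by rewrite powRM// ltW//; [case: (simF i)|case: (simG b)] => /andP[].
Qed.

(** Substitute the cover without the [i0]-th piece into itself [n] times, starting from [K] as its
    own cover. *)
Lemma shrinking_covers (I : finType) (F : I -> X -> X) (c : I -> R) K (i0 : I)
    (D t : R) n :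
  (forall i, similitude (F i) (c i)) ->
  K `<=` \bigcup_(i in [set i | i <> i0]) (F i @` K) ->
  0 < D -> (forall x y, K x -> K y -> mdist x y <= D) ->
  exists (M : finType) (P : {set M}) (U : M -> set X) (d : M -> R),
    [/\ forall p, 0 < d p,
        forall p x y, U p x -> U p y -> mdist x y <= d p,
        K `<=` \bigcup_(p in [set` P]) U p
      & \sum_(p in P) d p `^ t = (\sum_(i | i != i0) c i `^ t) ^+ n * D `^ t].
Proof.
move=> simF KF D0 KD.
elim: n => [|n [M [P [U [d [d0 dU KU sumd]]]]]].
  exists unit, [set: unit]%SET, (fun=> K), (fun=> D); split => //.
    by move=> x Kx; exists tt => //=; rewrite inE.
  by rewrite expr0 mul1r (big_pred1 tt)// => -[]; rewrite !inE.
have c0 i : 0 < c i by case: (simF i) => /andP[].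
exists (I * M)%type, [set p | (p.1 != i0) && (p.2 \in P)]%SET,
  (fun p => F p.1 @` U p.2), (fun p => c p.1 * d p.2); split.
- by move=> p; rewrite mulr_gt0.
- move=> p _ _ [x Ux <-] [y Uy <-]; case: (simF p.1) => _ ->.
  by rewrite ler_pM2l//; exact: dU.
- move=> x /KF [i ii0 [y /KU [p pP Uy] <-]]; exists (i, p); last by exists y.
  by rewrite /= inE /=; apply/andP; split => //; apply/eqP.
- rewrite exprS -mulrA -sumd mulr_suml.
  rewrite (eq_bigr (fun i => \sum_(p in P) (c i * d p) `^ t)); last first.
    move=> i _; rewrite mulr_sumr; apply: eq_bigr => p _.
    by rewrite powRM// ltW.
  by rewrite pair_big/=; apply: eq_bigl => p; rewrite inE.
Qed.

(** An arbitrary finite index type lets this apply to the words of any fixed length. *)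
Lemma strong_open_set_piece_not_redundant (I : finType) (F : I -> X -> X)
    (c : I -> R) K V (i0 : I) :
  (2 <= #|I|)%N -> (forall i, similitude (F i) (c i)) ->
  compact K -> K = \bigcup_i (F i @` K) ->
  open V -> (forall i, F i @` V `<=` V) ->
  (forall i j x y, V x -> V y -> F i x = F j y -> i = j) ->
  V `&` K !=set0 ->
  \bigcup_(i in [set i | i <> i0]) (F i @` K) <> K.
Proof.
move=> I2 simF cK KE oV FV Fdisj [x [Vx Kx]] KF.
have FK i : F i @` K `<=` K by move=> y Fy; rewrite KE; exists i.
have [t [t0 S1 g1]] : exists t : R, [/\ 0 <= t, 1 < \sum_i c i `^ t
    & \sum_(i | i != i0) c i `^ t < 1].
  by apply: powR_ratio_sums => // i; case: (simF i).
have [D D0 KD] := compact_mdist_ub cK cK.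
have [e /= e0 eV] : exists2 e : R, 0 < e & ball x e `<=` V.
  by apply/nbhs_ballP; exact: open_nbhs_nbhs.
(* A ratio below [e / D] shrinks [K] into the ball around [x] contained in [V]. *)
have [phi [rho [simphi phiK [k0 Kk0 phik0] rhoe]]] :=
  exists_small_piece simF KE Kx (divr_gt0 e0 D0).
have [/andP[rho0 rho1] phiE] := simphi.
have phiV k : K k -> V (phi k).
  move=> Kk; apply: eV; rewrite ballEmdist/= -phik0 phiE.
  by rewrite (le_lt_trans (ler_wpM2l (ltW rho0) (KD _ _ Kk0 Kk)))// -ltr_pdivlMr.
(* Enough iterations compensate for the fixed loss caused by the ratio [rho] of [phi]. *)
have [n Sn] : exists n, 1 <= (\sum_i c i `^ t) ^+ n.+1 * rho `^ t.
  set S := \sum_i _ in S1 *; have S0 : 0 < S by lra.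
  have /cvgr_lt /(_ (rho `^ t)) : S^-1 ^+ n @[n --> \oo] --> 0.
    by apply: cvg_expr; rewrite ger0_norm ?invr_ge0 ?ltW// invf_lt1.
  move=> /(_ (powR_gt0 _ rho0)) [n _ /(_ n.+1 (leqnSn n))/=]; rewrite exprVn => Sn.
  by exists n; rewrite -ler_pdivrMl ?exprn_gt0// mulr1 ltW.
have [J [G [r [[J2 simG] GK GV Gdisj sumr]]]] :=
  iterated_family t n I2 simF FK FV Fdisj.
have simH b : similitude (G b \o phi) (r b * rho) by exact: similitude_comp.
(* The images of [K] under the maps [G b \o phi] are compact, and disjoint because [phi] sends [K]
   into [V]. *)
have [delta delta0 sep] : exists2 delta : R, 0 < delta & forall b b' y z,
    b != b' -> K y -> K z -> delta <= mdist ((G b \o phi) y) ((G b' \o phi) z).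
  have cH b : compact ((G b \o phi) @` K).
    apply: continuous_compact => //.
    exact/continuous_subspaceT/(similitude_continuous (simH b)).
  have nd : \forall d \near 0^'+, forall b b', b != b' -> forall y z,
      ((G b \o phi) @` K) y -> ((G b' \o phi) @` K) z -> d <= mdist y z.
    apply: filter_forall => b; apply: filter_forall => b'.
    have [->|bb'] := eqVneq b b'; first exact: nearW.
    have := compact_mdist_lb (cH b) (cH b').
    move=> H; apply: filterS (H _) => [d dH _|]; first exact: dH.
    rewrite -subset0 => _ [[y Ky <-] [z Kz]] /= /esym GG.
    by move: bb'; rewrite (Gdisj _ _ _ _ (phiV _ Ky) (phiV _ Kz) GG) eqxx.
  near (0 : R)^'+ => d; exists d => [|b b' y z bb' Ky Kz].
    by near: d; exact: nbhs_right_gt.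
  have dP : forall b b', b != b' -> forall y z,
      ((G b \o phi) @` K) y -> ((G b' \o phi) @` K) z -> d <= mdist y z by near: d.
  exact: (dP b b').
set g := \sum_(i | i != i0) _ in g1.
have g0 : 0 <= g by apply: sumr_ge0 => *; exact: powR_ge0.
(* For [m] large, the cover that avoids [i0] has content below the lower bound given by [delta]. *)
have /cvgr_lt /(_ (delta `^ t / D `^ t)) : g ^+ n @[n --> \oo] --> 0.
  by apply: cvg_expr; rewrite ger0_norm.
move=> /(_ (divr_gt0 (powR_gt0 _ delta0) (powR_gt0 _ D0))) [m _ /(_ m (leqnn m))/=].
rewrite ltr_pdivlMr ?powR_gt0// => gm.
have [M [P [U [d [d0 dU KU sumd]]]]] : exists (M : finType) (P : {set M})
    (U : M -> set X) (d : M -> R), [/\ forall p, 0 < d p,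
      forall p x y, U p x -> U p y -> mdist x y <= d p,
      K `<=` \bigcup_(p in [set` P]) U p
    & \sum_(p in P) d p `^ t = g ^+ m * D `^ t].
  by apply: (shrinking_covers t m simF) => //; rewrite KF.
suff : delta `^ t <= \sum_(p in P) d p `^ t by rewrite sumd leNgt gm.
apply: (separated_cover_content_lb (U := U) J2 _ simH _ sep) => //.
- by exists x.
- by move=> b _ [y Ky <-]; apply: GK; exists (phi y) => //; apply: phiK; exists y.
- rewrite (eq_bigr (fun b => r b `^ t * rho `^ t)); last first.
    by move=> b _; rewrite powRM// ?(ltW rho0)// ltW//; case: (simG b) => /andP[].
  by rewrite -mulr_suml sumr.
Unshelve. all: by end_near. Qed.

End similitudes.

(** * Words, levels and the step from SOSC to WSC *)

Lemma word_map_similitude (R : realType) (X : metricType R) (k : nat)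
    (f : 'I_k -> X -> X) (c : 'I_k -> R) (w : seq 'I_k) :
  (forall i, similitude (f i) (c i)) -> (0 < size w)%N ->
  exists d, similitude (word_map f w) d.
Proof.
move=> simf; elim: w => // i [|j w] IHw _; first by exists (c i); exact: (simf i).
have [d simd] := IHw isT.
by exists (c i * d); exact: similitude_comp.
Qed.

Lemma word_map_preserve (T : topologicalType) (k : nat) (f : 'I_k -> T -> T)
    (V : set T) (w : seq 'I_k) (x : T) :
  (forall i, f i @` V `<=` V) -> V x -> V (word_map f w x).
Proof.
move=> fV Vx; elim: w => //= i w IHw.
by apply: (fV i); exists (word_map f w x).
Qed.

Lemma word_map_disjoint (T : topologicalType) (k : nat) (f : 'I_k -> T -> T)
    (V : set T) (v w : seq 'I_k) (x y : T) :
  (forall i, f i @` V `<=` V) -> (forall i, injective (f i)) ->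
  trivIset setT (fun i => f i @` V) ->
  size v = size w -> V x -> V y -> word_map f v x = word_map f w y -> v = w.
Proof.
move=> fV finj tV; elim: v w => [|i v IHv] [|j w]//= [vw] Vx Vy fvw.
have ij : i = j.
  apply: tV => //; exists (f i (word_map f v x)); split.
    by exists (word_map f v x) => //; exact: word_map_preserve.
  by rewrite fvw; exists (word_map f w y) => //; exact: word_map_preserve.
by move: fvw; rewrite ij => /finj /(IHv w vw Vx Vy) ->.
Qed.

Lemma fractal_level_cover (T : topologicalType) (k : nat) (f : 'I_k -> T -> T)
    (K : set T) (n : nat) :
  K = \bigcup_i (f i @` K) -> K = \bigcup_w (@fractal_level _ _ f K n w).
Proof.
move=> KE; have fK i : f i @` K `<=` K by move=> y fy; rewrite KE; exists i.
apply/seteqP; split => [|_ [w _ [x Kx <-]]]; last exact: word_map_preserve.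
elim: n => [x Kx|n IHn]; first by exists [tuple] => //; exists x.
rewrite {1}KE => _ [i _ [x /IHn[w _ [y Ky <-]] <-]].
by exists [tuple of i :: w] => //; exists y.
Qed.

Lemma sosc_wsc (R : realType) (X : metricType R) (k : nat)
    (f : 'I_k -> X -> X) (c : 'I_k -> R) (K : set X) :
  (2 <= k)%N -> (forall i, similitude (f i) (c i)) -> self_similar f K ->
  sosc f K -> wsc f K.
Proof.
move=> k2 simf [_ cK KE] [V [oV _ tV fV VK]] n n1 w.
have simw (u : n.-tuple 'I_k) : exists d, similitude (word_map f u) d.
  by apply: word_map_similitude simf _; rewrite size_tuple.
have [d simd] := choice simw.
apply: (strong_open_set_piece_not_redundant (V := V) _ simd) => //.
- rewrite card_tuple card_ord (leq_trans k2)//.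
  by rewrite -{1}(expn1 k) leq_pexp2l// ltnW.
- exact: fractal_level_cover.
- by move=> u _ [x Vx <-]; exact: word_map_preserve.
- move=> u v x y Vx Vy uv; apply: val_inj.
  apply: (word_map_disjoint fV _ tV _ Vx Vy uv); last by rewrite !size_tuple.
  by move=> i; exact: similitude_inj (simf i).
Qed.

(** * Existence and uniqueness of self-similar sets *)

Lemma self_similar_subset (R : realType) (X : metricType R) (k : nat)
    (f : 'I_k -> X -> X) (c : 'I_k -> R) (K K' : set X) :
  (forall i, similitude (f i) (c i)) -> self_similar f K ->
  self_similar f K' -> K' `<=` K.
Proof.
move=> simf [[x0 Kx0] cK KE] [_ cK' K'E] x K'x.
have [C [/andP[C0 C1] cC]] := similitude_family_ratio simf.
have [D D0 KD] := compact_mdist_ub cK' cK.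
(* Take [n] letters of an address of [y] in [K'] and apply the same maps to [x0] in [K]; the
   distance contracts by [C] at each letter. *)
have approx n : forall y, K' y -> exists2 z, K z & mdist y z <= C ^+ n * D.
  elim: n => [y K'y|n IHn y]; first by exists x0; rewrite ?expr0 ?mul1r; auto.
  rewrite {1}K'E => -[i _ [z /IHn[w Kw zw] <-]].
  exists (f i w); first by rewrite KE; exists i => //; exists w.
  case: (simf i) => /andP[ci0 _] ->.
  by rewrite exprS -mulrA ler_pM ?mdist_ge0// ltW.
have clK : closed K by exact: compact_closed (@metric_hausdorff _ X) cK.
apply: clK => B /nbhs_ballP[e /= e0 eB].
have /cvgr_lt /(_ (e / D)) : C ^+ n @[n --> \oo] --> 0.
  by apply: cvg_expr; rewrite gtr0_norm.
move=> /(_ (divr_gt0 e0 D0)) [n _ /(_ n (leqnn n))/=].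
rewrite ltr_pdivlMr// => Cn; have [z Kz xz] := approx n x K'x.
exists z; split => //; apply: eB; rewrite ballEmdist/=.
exact: le_lt_trans xz Cn.
Qed.

(** The orbit of a fixed point is the union of its images, and this passes to closures since a
    finite union of compact images is closed. *)
Lemma closure_orbit_self_similar (R : realType) (X : metricType R) (k : nat)
    (f : 'I_k -> X -> X) (c : 'I_k -> R) (B : set X) (i0 : 'I_k) (x0 : X) :
  (forall i, similitude (f i) (c i)) -> compact B -> f i0 x0 = x0 ->
  (forall w, B (word_map f w x0)) ->
  closure [set word_map f w x0 | w in setT] `<=` B /\
  self_similar f (closure [set word_map f w x0 | w in setT]).
Proof.
move=> simf cB fx0 orbB; set O := [set word_map f w x0 | w in setT].
have clB : closed B by exact: compact_closed (@metric_hausdorff _ X) cB.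
have KB : closure O `<=` B.
  rewrite (closure_id B).1//; apply: closure_subset => _ [w _ <-]; exact: orbB.
have cK : compact (closure O) := subclosed_compact (@closed_closure _ _) cB KB.
split => //; split => //.
  by exists x0; apply: subset_closure; exists [::].
apply/seteqP; split.
  have : closed (\bigcup_i (f i @` closure O)).
    apply: closed_bigcup; first exact: finite_finset.
    move=> i _; apply: compact_closed (@metric_hausdorff _ X) _.
    apply: continuous_compact cK.
    exact/continuous_subspaceT/(similitude_continuous (simf i)).
  (* The empty word gives [x0], which lies in the image under [f i0] because it is fixed. *)
  move=> /closure_id ->; apply: closure_subset => _ [[|i w] _ <-].
    by exists i0 => //; exists x0 => //; apply: subset_closure; exists [::].
  exists i => //; exists (word_map f w x0) => //.
  by apply: subset_closure; exists w.
move=> _ [i _ [x Ox <-]] A nA.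
have [_ [[w _ <-] Aw]] := Ox _ (similitude_continuous (simf i) nA).
by exists (f i (word_map f w x0)); split => //; exists (i :: w).
Qed.

HB.instance Definition _ (R : realType) := Metric.on R^o.

(** * Base 7 values of words *)

Section digits.
Implicit Types (d : 'I_5 -> nat) (w : seq 'I_5).

(* The letters 0, .., 3 of ['I_5] stand for the digits 0, .., 3 and the letter 4
   for the digit [tau]. *)
Definition unit_digit (i : 'I_5) : nat := if (i < 4)%N then (i : nat) else 0%N.
Definition tau_digit (i : 'I_5) : nat := (i == 4 :> nat).

Fixpoint digits7 d w : nat :=
  if w is i :: w' then (d i * 7 ^ size w' + digits7 d w')%N else 0%N.

Lemma unit_digits_le w : (2 * digits7 unit_digit w < 7 ^ size w)%N.
Proof.
elim: w => //= i w IHw; rewrite expnS.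
have : (unit_digit i <= 3)%N by rewrite /unit_digit; case: ltnP.
by nia.
Qed.

Lemma tau_digits_le w : (6 * digits7 tau_digit w < 7 ^ size w)%N.
Proof.
elim: w => //= i w IHw; rewrite expnS.
have : (tau_digit i <= 1)%N by rewrite /tau_digit leq_b1.
by nia.
Qed.

(** Tails have values below [7 ^ size w], so leading digits of both kinds agree, and together they
    determine the letter. *)
Lemma digits7_inj v w : size v = size w ->
  digits7 unit_digit v = digits7 unit_digit w ->
  digits7 tau_digit v = digits7 tau_digit w -> v = w.
Proof.
elim: v w => [|i v IHv] [|j w]//= [vw]; rewrite vw.
have := unit_digits_le v; have := unit_digits_le w.
have := tau_digits_le v; have := tau_digits_le w.
rewrite vw; set N := (7 ^ size w)%N => tw tv uw uv up tp.
have ui : unit_digit i = unit_digit j by nia.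
have ti : tau_digit i = tau_digit j by nia.
have -> : i = j.
  have digitE (h : 'I_5) : h = (unit_digit h + 4 * tau_digit h)%N :> nat.
    by case: h => -[|[|[|[|[|//]]]]].
  by apply/val_inj; rewrite /= digitE ui ti -digitE.
congr (_ :: _); apply: IHv => //; first by move: up; rewrite ui; lia.
by move: tp; rewrite ti; lia.
Qed.

End digits.

(** * The five maps of the line and their attractor *)

Section line_family.
Context {R : realType}.
Implicit Types (tau : R) (v w : seq 'I_5).

Definition line_map tau (i : 'I_5) : R^o -> R^o :=
  fun x => (x + (unit_digit i)%:R + tau * (tau_digit i)%:R) / 7.

Lemma line_map_similitude tau i : similitude (line_map tau i) (7^-1 : R).
Proof.
split; first by rewrite invr_gt0 ltr0n invf_lt1 ?ltr1n// ltr0n.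
move=> x y; rewrite /mdist/= /line_map -mulrBl normrM mulrC.
rewrite gtr0_norm ?invr_gt0 ?ltr0n//; congr (_ * `|_|); ring.
Qed.

Definition word_value tau w : R :=
  (digits7 unit_digit w)%:R + tau * (digits7 tau_digit w)%:R.

Lemma word_map_line tau w x :
  word_map (line_map tau) w x = (x + word_value tau w) / 7 ^+ size w.
Proof.
rewrite /word_value; elim: w => /= [|i w ->]; first by field.
rewrite /line_map !natrD !natrM !natrX exprS; field.
by rewrite expf_neq0// pnatr_eq0.
Qed.

(** Unit digits contribute less than 1/2 and [tau] digits less than 1/6 of [7 ^+ size w]. That 2/3
    is below 1 later rules out nonzero integers. *)
Lemma word_value_bounds tau w : 0 <= tau <= 1 ->
  0 <= word_value tau w <= 2 / 3 * 7 ^+ size w.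
Proof.
move=> /andP[t0 t1]; rewrite /word_value.
set P : R := (digits7 unit_digit w)%:R; set Q : R := (digits7 tau_digit w)%:R.
have Pw : 2 * P < 7 ^+ size w by rewrite -natrM -natrX ltr_nat unit_digits_le.
have Qw : 6 * Q < 7 ^+ size w by rewrite -natrM -natrX ltr_nat tau_digits_le.
have P0 : 0 <= P :> R by exact: ler0n.
have Q0 : 0 <= Q :> R by exact: ler0n.
by apply/andP; split; nra.
Qed.

Definition line_attractor tau : set R^o :=
  closure [set word_map (line_map tau) w 0 | w in setT].

Lemma line_attractorP tau : 0 <= tau <= 1 ->
  is_attractor (line_map tau) (line_attractor tau) /\
  line_attractor tau `<=` [set x | 0 <= x <= 2 / 3].
Proof.
move=> tau01.
have cB : compact ([set x | 0 <= x <= 2 / 3] : set R^o).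
  have -> : [set x | 0 <= x <= 2 / 3] = `[0, (2 / 3 : R)]%classic.
    by apply/seteqP; split => x; rewrite /= in_itv.
  exact: segment_compact.
have [||KB ssK] := closure_orbit_self_similar (i0 := ord0)
    (line_map_similitude tau) cB (x0 := 0 : R^o).
- by rewrite /line_map /unit_digit /tau_digit/= mulr0 !addr0 mul0r.
- move=> w; have /andP[v0 v1] := word_value_bounds w tau01.
  have w0 : 0 < 7 ^+ size w :> R by rewrite exprn_gt0.
  rewrite word_map_line add0r /=; apply/andP; split.
    by rewrite divr_ge0// ltW.
  by rewrite ler_pdivrMr.
split => //; split => // K' ssK'; apply/seteqP; split.
  exact: self_similar_subset (line_map_similitude tau) ssK' ssK.
exact: self_similar_subset (line_map_similitude tau) ssK ssK'.
Qed.

(** * Choice of the parameter by Baire category *)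

(* Two terms of an arithmetic progression of step [3 / 7 ^+ m] cannot violate
   the inequality for the same word [z], and an interval contains more than
   [5 ^ m] such terms for large [m]. *)
Lemma dense_far_from_words (a b : int) : b != 0 ->
  dense (\bigcup_m [set tau : R^o | forall z : m.-tuple 'I_5,
    7 ^- m < `|a%:~R + tau * b%:~R - word_value tau z / 7 ^+ m|]).
Proof.
move=> b0 O [y Oy] oO.
have [e /= e0 eO] : exists2 e : R, 0 < e & ball y e `<=` O.
  by apply/nbhs_ballP; exact: open_nbhs_nbhs.
have [m me] : exists m : nat, 3 * (5 / 7) ^+ m < e.
  have /cvgr_lt /(_ (e / 3)) : (5 / 7 : R) ^+ n @[n --> \oo] --> 0.
    by apply: cvg_expr; rewrite ger0_norm; lra.
  rewrite divr_gt0// => /(_ isT) [m _ /(_ m (leqnn m))/=].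
  by rewrite ltr_pdivlMr// mulrC; exists m.
(* The choice of [m] keeps [5 ^ m + 1] terms within [e] of [y], one more than there are words. *)
have m7 : 0 < 7 ^+ m :> R by rewrite exprn_gt0.
pose t (l : 'I_(5 ^ m).+1) : R := y + 3 * l%:R / 7 ^+ m.
have Ot : forall l, O (t l).
  move=> l; apply: eO; rewrite /ball/= /t opprD addNKr normrN.
  rewrite ger0_norm; last first.
    by rewrite divr_ge0 ?mulr_ge0// ltW.
  apply: le_lt_trans me; rewrite expr_div_n [leRHS]mulrA ler_pM2r ?invr_gt0//.
  by rewrite ler_pM2l// -natrX ler_nat -ltnS.
have [[k far]|near_word] := pselect (exists l, forall z : m.-tuple 'I_5,
    7 ^- m < `|a%:~R + t l * b%:~R - word_value (t l) z / 7 ^+ m|).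
  by exists (t k); split => //; exists m.
have {}near_word l : exists z : m.-tuple 'I_5,
    `|a%:~R + t l * b%:~R - word_value (t l) z / 7 ^+ m| <= 7 ^- m.
  apply/not_existsP => H; apply: near_word; exists l => z.
  by rewrite ltNge; apply/negP/H.
have [z zP] := choice near_word.
have /injectivePn[l [l' ll' zz]] : ~~ injectiveb z.
  apply/injectiveP => /leq_card.
  by rewrite card_ord card_tuple card_ord ltnn.
exfalso; wlog {ll'} ll' : l l' zz / (l < l')%N.
  move=> H; move: ll'; rewrite neq_ltn => /orP[]; first exact: H.
  exact: H.
have := zP l; have := zP l'; rewrite -zz /word_value /t.
set P : R := (digits7 unit_digit _)%:R; set Q : R := (digits7 tau_digit _)%:R.
have Q0 : 0 <= Q by exact: ler0n.
have Qm : 6 * Q < 7 ^+ m.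
  by rewrite -[m in 7 ^+ m](size_tuple (z l)) -natrM -natrX ltr_nat tau_digits_le.
have lR : l%:R + 1 <= l'%:R :> R by rewrite natr1 ler_nat.
have bR : (b%:~R <= -1 :> R) || (1 <= b%:~R :> R).
  have : (b <= -1) || (1 <= b) by lia.
  by case/orP=> h; apply/orP; [left|right]; rewrite -(ler_int R) in h.
set u : R := 7 ^- m; have u0 : 0 < u by rewrite invr_gt0.
have Qu : 6 * (Q * u) < 1 by rewrite mulrA ltr_pdivrMr// mul1r.
have Qu0 : 0 <= Q * u by rewrite mulr_ge0// ltW.
move=> /ler_normlP[A1 A2] /ler_normlP[B1 B2].
(* Subtracting the two estimates bounds [s] by 2 in absolute value. But [Q * u < 1 / 6] and [b] is a
   nonzero integer, so [s] is at least 3 * 5/6 in absolute value. *)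
pose s : R := 3 * (l'%:R - l%:R) * (b%:~R - Q * u).
have su1 : s * u <= 2 * u by rewrite /s; lra.
have su2 : - 2 * u <= s * u by rewrite /s; lra.
move: su1 su2; rewrite !ler_pM2r// /s.
by case/orP: bR => bR; nra.
Qed.

(** For each [m] there are finitely many words, each giving a strict inequality between continuous
    functions of [tau]. *)
Lemma open_far_from_words (a b : int) :
  open (\bigcup_m [set tau : R^o | forall z : m.-tuple 'I_5,
    7 ^- m < `|a%:~R + tau * b%:~R - word_value tau z / 7 ^+ m|]).
Proof.
apply: bigcup_open => m _; rewrite openE => tau far.
apply: (@filter_forall _ _ (fun (z : m.-tuple 'I_5) (t : R^o) =>
  7 ^- m < `|a%:~R + t * b%:~R - word_value t z / 7 ^+ m|) (nbhs tau)) => z.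
apply: cvgr_gt (far z).
apply: cvg_norm; apply: cvgB.
  by apply: cvgD; [exact: cvg_cst|apply: cvgMl].
apply: cvgMl; apply: cvgD; [exact: cvg_cst|exact: cvgMl].
Qed.

(** The integer [p] nearest to [7 * y] is a balanced digit in -3, .., 3, hence a difference of two
    unit digits, and the remainder returns to the same interval. *)
Lemma balanced_base7_approx n (y : R) : - 2^-1 <= y < 2^-1 ->
  exists u v : n.-tuple 'I_5,
    [/\ digits7 tau_digit u = 0%N, digits7 tau_digit v = 0%N
      & `|y - ((digits7 unit_digit u)%:R - (digits7 unit_digit v)%:R) / 7 ^+ n|
        <= 7 ^- n].
Proof.
elim: n y => [|n IHn] y /andP[y0 y1].
  exists [tuple], [tuple]; split => //=.
  by rewrite subrr mul0r subr0 expr0 invr1 ler_norml; lra.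
pose p := Num.floor (7 * y + 2^-1).
have pl : p%:~R <= 7 * y + 2^-1 by exact: floor_le.
have pr : 7 * y + 2^-1 < p%:~R + 1.
  by have := floorD1_gt (7 * y + 2^-1); rewrite intrD1.
have [|u [v [tu tv uv]]] := IHn (7 * y - p%:~R); first by lra.
have p3 : -3 <= p <= 3.
  have : -4 < p < 4 by rewrite -!(ltr_int R); apply/andP; split; lra.
  lia.
have [i [j [ti tj ij]]] : exists i j : 'I_5,
    [/\ tau_digit i = 0%N, tau_digit j = 0%N
      & p = (unit_digit i)%:Z - (unit_digit j)%:Z].
  move: p p3 {pl pr uv} => [[|[|[|[|?]]]]|[|[|[|?]]]]; rewrite //= ?NegzE => _.
  - by exists (inord 0), (inord 0); rewrite /tau_digit /unit_digit !inordK.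
  - by exists (inord 1), (inord 0); rewrite /tau_digit /unit_digit !inordK.
  - by exists (inord 2), (inord 0); rewrite /tau_digit /unit_digit !inordK.
  - by exists (inord 3), (inord 0); rewrite /tau_digit /unit_digit !inordK.
  - by exists (inord 0), (inord 1); rewrite /tau_digit /unit_digit !inordK.
  - by exists (inord 0), (inord 2); rewrite /tau_digit /unit_digit !inordK.
  - by exists (inord 0), (inord 3); rewrite /tau_digit /unit_digit !inordK.
exists [tuple of i :: u], [tuple of j :: v].
split; rewrite /= ?ti ?tj ?tu ?tv// !size_tuple !natrD !natrM !natrX.
have n7 : 0 < 7 ^+ n :> R by rewrite exprn_gt0.
have pij : p%:~R = (unit_digit i)%:R - (unit_digit j)%:R :> R.
  by rewrite ij rmorphB/=.
set w := `|_|; have -> : w = `|7 * y - p%:~R - ((digits7 unit_digit u)%:R -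
    (digits7 unit_digit v)%:R) / 7 ^+ n| / 7.
  rewrite /w -[X in _ = _ / X](@gtr0_norm _ 7)// -normf_div pij; congr `|_|.
  by rewrite exprS; field; rewrite gt_eqF.
by rewrite exprS invfM mulrC ler_pM2l ?invr_gt0.
Qed.

Lemma exists_liouville_parameter : exists tau : R,
  [/\ 0 <= tau <= 1,
      forall e : R, 0 < e -> exists n (u v : n.-tuple 'I_5),
        [/\ digits7 tau_digit u = 0%N, digits7 tau_digit v = 0%N
          & `|7 ^+ n * tau - ((digits7 unit_digit u)%:R
                              - (digits7 unit_digit v)%:R)| < e]
    & forall a b : int, b != 0 -> exists m, forall z : m.-tuple 'I_5,
        7 ^- m < `|a%:~R + tau * b%:~R - word_value tau z / 7 ^+ m|].
Proof.
pose D (s : R) n := exists u v : n.-tuple 'I_5,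
  [/\ digits7 tau_digit u = 0%N, digits7 tau_digit v = 0%N
    & s * 7 ^+ n = (digits7 unit_digit u)%:R - (digits7 unit_digit v)%:R].
(* Multiplied by [7 ^+ n], the radius becomes [k.+1%:R^-1]. The two half-lines make [W k] dense in
   the whole line, although balanced expansions reach only a bounded interval. *)
pose W k : set R^o := [set tau | tau < 0] `|` [set tau | 3^-1 < tau] `|`
  \bigcup_(p in [set p | D p.1 p.2]) ball (p.1 : R^o) (k.+1%:R^-1 / 7 ^+ p.2).
(* For [tau] in [0, 1], a piece of level [m] lies within [7 ^- m] of the point of its word, so such
   a [tau] keeps [a + tau * b] out of the attractor. *)
pose far (a b : int) : set R^o := \bigcup_m [set tau : R^o |
  forall z : m.-tuple 'I_5,
    7 ^- m < `|a%:~R + tau * b%:~R - word_value tau z / 7 ^+ m|].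
(* Decoding [k] as a pair of integers merges both countable families of conditions into one
   sequence. *)
pose F k := W k `&` (if unpickle k is Some (a, b) then
  if b == 0 then setT else far a b else setT).
have oW k : open (W k).
  apply: openU; last by apply: bigcup_open => p _; exact: ball_open.
  by apply: openU; [exact: open_lt|exact: open_gt].
have dW k : dense (W k).
  move=> O [y Oy] oO.
  have [y0|y0] := ltP y 0; first by exists y; split => //; left; left.
  have [y1|y1] := ltP 3^-1 y; first by exists y; split => //; left; right.
  have [e /= e0 eO] : exists2 e : R, 0 < e & ball y e `<=` O.
    by apply/nbhs_ballP; exact: open_nbhs_nbhs.
  have /cvgr_lt /(_ _ e0) [n _ /(_ n (leqnn n))/=] :
      (7^-1 : R) ^+ n @[n --> \oo] --> 0.
    by apply: cvg_expr; rewrite ger0_norm; lra.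
  rewrite exprVn => ne.
  have [|u [v [tu tv uv]]] := @balanced_base7_approx n y; first by lra.
  have n7 : 0 < 7 ^+ n :> R by rewrite exprn_gt0.
  exists (((digits7 unit_digit u)%:R - (digits7 unit_digit v)%:R) / 7 ^+ n).
  split; first by apply: eO; exact: le_lt_trans uv ne.
  right; exists (((digits7 unit_digit u)%:R - (digits7 unit_digit v)%:R) / 7 ^+ n, n).
    by exists u, v; split => //=; rewrite divfK// gt_eqF.
  by apply: ballxx; rewrite divr_gt0.
have oF k : open (F k).
  apply: openI => //; case: unpickle => [[a b]|]; last exact: openT.
  by case: ifP => _; [exact: openT|exact: open_far_from_words].
have denseT : dense (setT : set R^o) by move=> O [y Oy] _; exists y.
have dF k : dense (F k).
  rewrite /F; apply: denseI => //.
  case: unpickle => [[a b]|]; last exact: denseT.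
  case: ifP => b0; first exact: denseT.
  by apply: dense_far_from_words; rewrite b0.
(* Searching in (0, 1/3) avoids the two half-lines of [W k]. *)
have [tau [[/= t0 t1] Ft]] : (([set t | 0 < t] `&` [set t | t < 3^-1] : set R^o)
    `&` \bigcap_k F k) !=set0.
  apply: Baire => //; last by apply: openI; [exact: open_gt|exact: open_lt].
  by exists 6^-1; split; rewrite /=; lra.
exists tau; split => [|e e0|a b b0]; first by lra.
- have [k ke] : exists k : nat, k.+1%:R^-1 < e.
    have [k _ /(_ k (leqnn k))] := near_infty_natSinv_lt (PosNum e0).
    by exists k.
  have [[[/= ?|/= ?]|[[s n] [u [v [/= tu tv uv]]] st]] _] := Ft k I; [lra|lra|].
  exists n, u, v; split => //; rewrite -uv.
  have n7 : 0 < 7 ^+ n :> R by rewrite exprn_gt0.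
  apply: lt_trans ke; move: st; rewrite /ball/= ltr_pdivlMr//.
  by rewrite -[X in _ * X](gtr0_norm n7) -normrM mulrBl distrC [7 ^+ n * _]mulrC.
- have [_] := Ft (pickle (a, b)) I; rewrite pickleK (negbTE b0) => -[m _ mP].
  by exists m.
Qed.

End line_family.

(** * WSC without SOSC on the line *)

(* The fixed point [0] of the first map gives the witness: [word_map _ w 0] lies
   in no other piece of the same level.  A coincidence forces
   [a + tau * b = y] with [a], [b] integers and [y] in the attractor; if [b]
   is nonzero, [tau] was chosen so that this fails. *)
Lemma line_attractor_wsc (R : realType) (tau : R) : 0 <= tau <= 1 ->
  (forall a b : int, b != 0 -> exists m, forall z : m.-tuple 'I_5,
    7 ^- m < `|a%:~R + tau * b%:~R - word_value tau z / 7 ^+ m|) ->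
  wsc (line_map tau) (line_attractor tau).
Proof.
move=> tau01 far n n1 w Kw.
have [[[K0 cK KE] _] KB] := line_attractorP tau01.
have fK i : line_map tau i @` line_attractor tau `<=` line_attractor tau.
  by move=> x fx; rewrite KE; exists i.
have Kzero : line_attractor tau 0 by apply: subset_closure; exists [::].
have := word_map_preserve w fK Kzero; rewrite -{1}Kw => -[v /= vw [y Ky]].
have n7 : 7 ^+ n != 0 :> R by rewrite expf_neq0// pnatr_eq0.
rewrite !word_map_line add0r !size_tuple => /(divIf n7).
rewrite /word_value => yE; have /andP[y0 y1] := KB y Ky.
(* With equal [tau] parts, [y] is an integer in [0, 2/3], hence 0, and the unit parts agree too. *)
have [Qvw|Qvw] := eqVneq (digits7 tau_digit v) (digits7 tau_digit w).
  apply/vw/val_inj/digits7_inj => //; first by rewrite !size_tuple.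
  apply/eqP; rewrite eqn_leq -!(ler_nat R); move: yE; rewrite Qvw => yE.
  have : (digits7 unit_digit w)%:R < (digits7 unit_digit v).+1%:R :> R.
    by rewrite -natr1; lra.
  by rewrite ltr_nat ltnS -(ler_nat R) => ->; rewrite andbT; lra.
pose a := (digits7 unit_digit w)%:Z - (digits7 unit_digit v)%:Z.
pose b := (digits7 tau_digit w)%:Z - (digits7 tau_digit v)%:Z.
have [|m] := far a b; first by rewrite subr_eq0 eq_sym.
(* The piece of level [m] containing [y] puts it within [2 / 3 * 7 ^- m] of the point of [z],
   against the choice of [tau]. *)
have [z _ [y' Ky' zy]] : (\bigcup_(z : m.-tuple 'I_5)
    fractal_level (line_map tau) (line_attractor tau) z) y.
  by rewrite -fractal_level_cover.
move=> /(_ z); rewrite /a /b !rmorphB/=.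
have /andP[y'0 y'1] := KB y' Ky'.
have m7 : 0 < 7 ^+ m :> R by rewrite exprn_gt0.
set d := _ - _; have -> : d = y' / 7 ^+ m.
  have -> : d = y - word_value tau z / 7 ^+ m by rewrite /d; lra.
  by rewrite -zy word_map_line size_tuple -mulrBl addrK.
rewrite ger0_norm; last by rewrite divr_ge0// ltW.
by rewrite ltr_pdivlMr// mulVf ?gt_eqF//; lra.
Qed.

(* For words [u], [v] without the digit [tau], the words [4 :: v] and [0 :: u]
   give maps that differ by the translation by [7 ^+ n * tau - (u - v)] of the
   argument, which is smaller than the inradius of a given open set. *)
Lemma line_attractor_not_sosc (R : realType) (tau : R) :
  (forall e : R, 0 < e -> exists n (u v : n.-tuple 'I_5),
    [/\ digits7 tau_digit u = 0%N, digits7 tau_digit v = 0%N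
      & `|7 ^+ n * tau - ((digits7 unit_digit u)%:R
                          - (digits7 unit_digit v)%:R)| < e]) ->
  ~ sosc (line_map tau) (line_attractor tau).
Proof.
move=> liouville [V [oV [x Vx] tV fV _]].
have [e /= e0 eV] : exists2 e : R, 0 < e & ball x e `<=` V.
  by apply/nbhs_ballP; exact: open_nbhs_nbhs.
have [n [u [v [tu tv uv]]]] := liouville e e0.
(* Chosen so that the word [0 :: u] sends [x'] where [4 :: v] sends [x]. *)
pose x' : R^o := x + (7 ^+ n * tau - ((digits7 unit_digit u)%:R
                                     - (digits7 unit_digit v)%:R)).
have Vx' : V x'.
  by apply: eV; rewrite /ball/= /x' opprD addNKr normrN.
pose i4 : 'I_5 := @Ordinal 5 4 isT; pose i0 : 'I_5 := @Ordinal 5 0 isT.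
suff : i4 = i0 by [].
apply: tV => //; exists (line_map tau i4 (word_map (line_map tau) v x)); split.
  by exists (word_map (line_map tau) v x) => //; exact: word_map_preserve.
exists (word_map (line_map tau) u x'); first exact: word_map_preserve.
rewrite !word_map_line !size_tuple /word_value tu tv /line_map /x'.
rewrite /unit_digit /tau_digit/=; field.
by rewrite expf_neq0// pnatr_eq0.
Qed.

Theorem corollary7p4 (R : realType) :
  (forall (X : completeMetricType R) (k : nat) (f : 'I_k -> X -> X)
      (c : 'I_k -> R) (K : set X),
    (2 <= k)%N ->
    (forall i, similitude (f i) (c i)) ->
    is_attractor f K ->
    sosc f K -> wsc f K)
  /\
  (exists (X : completeMetricType R) (k : nat) (f : 'I_k -> X -> X)
      (c : 'I_k -> R) (K : set X),
    [/\ (2 <= k)%N,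
        forall i, similitude (f i) (c i),
        is_attractor f K,
        wsc f K
      & ~ sosc f K]).
Proof.
split=> [X k f c K k2 simf [ssK _]|]; first exact: sosc_wsc simf ssK.
have [tau [tau01 liouville far]] := @exists_liouville_parameter R.
exists R^o, 5, (line_map tau), (fun=> 7^-1), (line_attractor tau); split => //.
- exact: line_map_similitude.
- by have [] := line_attractorP tau01.
- exact: line_attractor_wsc.
- exact: line_attractor_not_sosc.
Qed.
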